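(* Let $p$ be a prime number. Let $\lambda$ be a regular cardinal and $\mu$ be an infinite cardinal. If $\mu^+<\lambda<\mu^{\aleph_0}$, then $\mathbf{K}^{p\text{-grp}}$ does not have a universal model of cardinality $\lambda$.
   Context: An abelian $p$-group is an abelian group in which every nonzero element has order $p^n$ for some $n\in\mathbb{N}$. A subgroup $G$ of an abelian group $H$ is pure, written $G\leq_p H$, if $nH\cap G=nG$ for every $n\in\mathbb{N}$. A pure embedding is an injective homomorphism whose image is a pure subgroup of the codomain. $\mathbf{K}^{p\text{-grp}}$ denotes the class of abelian $p$-groups ordered by $\leq_p$. For an infinite cardinal $\lambda$, $\mathbf{K}^{p\text{-grp}}$ has a universal model of cardinality $\lambda$ if there is an abelian $p$-group $U$ of cardinality $\lambda$ such that for every abelian $p$-group $N$ of cardinality $\lambda$ there is a pure embedding $N\to U$. *)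

(* Defs.v *)
From HB Require Import structures.
From mathcomp Require Import all_boot all_algebra.
From mathcomp Require Import all_classical wochoice.

Set Implicit Arguments.
Unset Strict Implicit.
Unset Printing Implicit Defensive.

Import GRing.Theory.

Local Open Scope classical_set_scope.
Local Open Scope card_scope.
Local Open Scope ring_scope.

(* A cardinal is represented by a type T, standing for the cardinality of
   [set: T]. *)

Definition card_lt T U (A : set T) (B : set U) : Prop :=
  A #<= B /\ ~ (B #<= A).

Definition is_succ_card (M S : Type) : Prop :=
  card_lt [set: M] [set: S] /\
  forall X : Type, card_lt [set: M] [set: X] -> [set: S] #<= [set: X].

(* [R] is a reflexive well-order on [T] whose order type is an initial ordinal,
   so that (T, R) is the cardinal |T| viewed as an ordinal. *)
Definition initial_well_order (T : Type) (R : rel T) : Prop :=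
  well_order R /\
  forall x : T, card_lt [set y | R y x /\ y <> x] [set: T].

Definition cofinal (T : Type) (R : rel T) (A : set T) : Prop :=
  forall x : T, exists2 y, A y & R x y.

(* cf |T| = |T|: since [set: T] is itself cofinal, this says that |T| is the
   least cardinality of a cofinal subset. Initial well-orders of [T] are all
   isomorphic, so the choice of [R] is immaterial. *)
Definition regular_card (T : Type) : Prop :=
  infinite_set [set: T] /\
  exists R : rel T, initial_well_order R /\
    forall A : set T, cofinal R A -> [set: T] #<= A.

(* The order #[x] of the library is only available in finite groups. *)
Definition has_order (G : zmodType) (x : G) (m : nat) : Prop :=
  [/\ (0 < m)%N, x *+ m = 0 &
      forall k : nat, (0 < k < m)%N -> x *+ k <> 0].

Definition abelian_p_group (p : nat) (G : zmodType) : Prop :=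
  forall x : G, x <> 0 -> exists n : nat, has_order x (p ^ n)%N.

Definition pure_subgroup (H : zmodType) (G : set H) : Prop :=
  zmod_closed [pred x in G] /\
  forall n : nat, [set x *+ n | x in [set: H]] `&` G = [set x *+ n | x in G].

Definition pure_embedding (G H : zmodType) (f : {additive G -> H}) : Prop :=
  injective f /\ pure_subgroup (range f).

Definition has_universal_p_group (p : nat) (L : Type) : Prop :=
  exists U : zmodType,
    [/\ abelian_p_group p U,
        [set: U] #= [set: L] &
        forall N : zmodType, abelian_p_group p N -> [set: N] #= [set: L] ->
          exists f : {additive N -> U}, pure_embedding f].

(* Main.v *)
Require Import Defs.
From HB Require Import structures.
From mathcomp Require Import all_boot all_algebra.
From mathcomp Require Import all_classical wochoice.

(** Suppose that U is universal. Enumerate U injectively by [g : U -> lambda]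
    and call the trace of [u] the set of pairs (x, m) for which u is congruent
    modulo p^(m+1) U to an element enumerated before x. Elements of U have
    at most lambda traces; the proof builds a p-group N of size lambda with an
    element whose image in U, under whatever pure embedding, would need a
    trace outside this list.

    Inside the product over n and over a in lambda of cyclic groups of order
    p^(n+1), with canonical generators e(n, a), a sequence a_0 <= a_1 <= ... in
    lambda gives the element t = e(0, a_0) + p e(1, a_1) + p^2 e(2, a_2) + ...
    Modulo p^(m+1), t is the finite sum over n <= m, and every element
    congruent to t modulo p^(m+1) has the coordinate (m, a_m) in its support.
    So t is congruent modulo p^(m+1) to something built before stage x exactly
    when a_m < x. Purity transports this to U, provided x is a stage at which
    the constructions of N and of U have caught up with each other, that is, a
    closure point of some function lambda -> lambda depending on the embedding
    ([trace_pure_embedding]). Hence, on a set c of closure points containing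
    all the a_m, the trace of the image of t determines the sequence a.

    If mu injects into c, then c contains mu^aleph_0 > lambda nondecreasing
    sequences, so some sequence in c is not described by the trace of any
    element of U ([avoiding_sequence]). It remains to prepare N for all
    embeddings at once. As mu^+ < lambda, there is a family of lambda sets such
    that every function on lambda has a member of the family consisting of
    closure points and of size at least mu ([weak_club_guessing]). N is
    generated by the e(n, a) and, for each set of the family, by the t of an
    avoiding sequence together with the quotients of its tails by powers of p.
    It has size lambda because an infinite cardinal equals the number of its
    finite sequences ([card_seq_le]). For a pure embedding of N into U, the
    member of the family guessed for its function gives the contradiction. *)

Set Implicit Arguments.
Unset Strict Implicit.
Unset Printing Implicit Defensive.

Import GRing.Theory.
Local Open Scope classical_set_scope.
Local Open Scope card_scope.

(** * Cardinal arithmetic *)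

Lemma cardT_leP (X Y : Type) :
  reflect (exists f : X -> Y, injective f) ([set: X] #<= [set: Y]).
Proof.
apply: (iffP card_leP) => [[f]|[f fI]].
  exists (fun x => set_val (f (to_setT x))) => x y /val_inj fxy.
  have := (inj : set_inj _ f) _ _ (in_setT _) (in_setT _) fxy.
  by move=> /(congr1 set_val).
have h : injective (fun x : [set: X] => to_setT (f (set_val x))).
  by move=> x y /(congr1 set_val) /= /fI /val_inj.
apply/injfunPex; exists (fun x : [set: X] => to_setT (f (set_val x))) => //.
by move=> x y _ _ /h.
Qed.

Lemma infiniteT_natP (X : Type) :
  infinite_set [set: X] -> exists f : nat -> X, injective f.
Proof. by move=> /infiniteP /cardT_leP. Qed.

(** Zorn's lemma for graphs of partial injections: a maximal one is defined
    everywhere or reaches everything. *)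
Lemma cardT_le_total (X Y : Type) :
  [set: X] #<= [set: Y] \/ [set: Y] #<= [set: X].
Proof.
pose P (G : set (X * Y)) := forall u v, G u -> G v -> u.1 = v.1 <-> u.2 = v.2.
have [F FP FT|G [GP Gmax]] := @Zorn_bigcup _ P.
  move=> u v [A FA Au] [B FB Bv].
  by have [AB|BA] := FT _ _ FA FB; [apply: (FP B)|apply: (FP A)] => //;
    [apply: AB|apply: BA].
have [/choice[f fG]|/existsNP[x Gx]] := pselect (forall x, exists y, G (x, y)).
  by left; apply/cardT_leP; exists f => x x' /(GP _ _ (fG x) (fG x')).
right; apply/cardT_leP.
suff /choice[f fG] : forall y, exists x, G (x, y).
  by exists f => y y' /(GP _ _ (fG y) (fG y')).
move=> y; apply: contrapT => Gy.
apply: (Gmax (G `|` [set (x, y)])).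
  split; last by move=> /(_ (x, y) (or_intror erefl)) h; apply: Gx; exists y.
  by apply: subsetUl.
move=> [u1 u2] [v1 v2] /= [Gu|[-> ->]] [Gv|[-> ->]] //.
- exact: GP Gu Gv.
- by split=> e; exfalso; [apply: Gx|apply: Gy]; subst; eexists; exact: Gu.
- by split=> e; exfalso; [apply: Gx|apply: Gy]; subst; eexists; exact: Gv.
Qed.

Section Square.
Variable T : Type.

Definition square_dom (G : set (T * T * T)) : set T :=
  [set a | exists c, G (a, a, c)].

(** G is the graph of an injection D * D -> D. The set D is not a separate
    datum: it is read off the diagonal, so that unions of chains make sense. *)
Definition square_graph (G : set (T * T * T)) : Prop :=
  [/\ forall u v, G u -> G v -> u.1 = v.1 <-> u.2 = v.2,
      forall a b c, G (a, b, c) ->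
        [/\ square_dom G a, square_dom G b & square_dom G c] &
      forall a b, square_dom G a -> square_dom G b -> exists c, G (a, b, c)].

(** If I is stable under pairing, contains a copy of D and embeds outside D,
    then [D `|` range e] injects into I by tagging with [i0] and [i1]; the
    new pairs can thus be coded by [pr] and sent into [range e], which is
    disjoint from the values already taken. *)
Lemma square_graph_extend (G : set (T * T * T)) (I : Type)
    (e : I -> T) (pr : I * I -> I) (j : square_dom G -> I) (i0 i1 : I) :
  square_graph G -> injective e -> (forall i, ~ square_dom G (e i)) ->
  injective pr -> injective j -> i0 <> i1 ->
  exists2 G', G `<` G' & square_graph G'.
Proof.
move=> [Gfun Gdom Gtot] eI eD prI jI i01.
set A := square_dom G in j jI eD Gdom Gtot *.
pose A' := A `|` range e.
have [k kI] : exists k : T -> I, {in A' &, injective k}.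
  have /choice[k kP] : forall x, exists y, A' x ->
      (exists a : A, val a = x /\ y = pr (i0, j a)) \/
      (exists i, e i = x /\ y = pr (i1, i)).
    move=> x; have [Ax|nAx] := pselect (A x).
      exists (pr (i0, j (SigSub (mem_set Ax)))) => _; left.
      by exists (SigSub (mem_set Ax)).
    have [[i _ ix]|ne] := pselect (range e x).
      by exists (pr (i1, i)) => _; right; exists i.
    by exists i0 => -[].
  exists k => x y; rewrite !inE => /kP[[a [<- ->]]|[i [<- ->]]].
    move=> /kP[[b [<- ->]]|[i [<- ->]]] /prI[]; last by move=> /i01.
    by move=> /jI->.
  move=> /kP[[b [<- ->]]|[i' [<- ->]]] /prI[]; first by move=> /esym/i01.
  by move=> ->.
pose N := [set u : T * T * T | [/\ A' u.1.1, A' u.1.2, ~ (A u.1.1 /\ A u.1.2) &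
  u.2 = e (pr (k u.1.1, k u.1.2))]].
have Ndom : square_dom (G `|` N) = A'.
  apply/seteqP; split=> a.
    move=> [c [Gc|[]//]].
    by left; have [] := Gdom _ _ _ Gc.
  move=> aA'; have [Aa|nAa] := pselect (A a).
    by case: Aa => c Gc; exists c; left.
  by exists (e (pr (k a, k a))); right; split => //= -[].
exists (G `|` N).
  split; first exact: subsetUl.
  move=> sub; have h : G (e i0, e i0, e (pr (k (e i0), k (e i0)))).
    by apply: sub; right; split=> /=; [right; exists i0|right; exists i0|case=> /eD|].
  by have [/eD] := Gdom _ _ _ h.
split; rewrite ?Ndom.
- have GN u v : G u -> N v -> u.1 = v.1 <-> u.2 = v.2.
    move: u v => [[a b] c] [[a' b'] c'] /Gdom[/= Aa Ab Ac] [/= _ _ nA c'E].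
    split=> [[aE bE]|cE]; exfalso.
      by apply: nA; rewrite -aE -bE.
    by apply: (eD (pr (k a', k b'))); rewrite -c'E -cE.
  move=> u v [Gu|Nu] [Gv|Nv]; [exact: Gfun|exact: GN| |].
    by split=> /esym /(GN _ _ Gv Nu) /esym.
  move: u v Nu Nv => [[a b] c] [[a' b'] c'] [/= Aa Ab _ ->] [/= Aa' Ab' _ ->].
  split=> [[-> ->]//|/eI /prI[/kI + /kI]].
  by rewrite !inE => -> // ->.
- move=> a b c [/Gdom[Aa Ab Ac]|[/= ? ? ? ->]]; split=> //; try by left.
  by right; exists (pr (k a, k b)).
- move=> a b Aa Ab; have [[Da Db]|nAab] := pselect (A a /\ A b).
    by have [c Gc] := Gtot _ _ Da Db; exists c; left.
  by exists (e (pr (k a, k b))); right.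
Qed.

End Square.

(** Hessenberg's theorem. For a maximal injection D * D -> D, the complement
    of D cannot contain a copy of D (or of nat, if D is finite), so it is
    smaller than D; then T injects into D * D, hence into D. *)
Lemma card_square_le (T : Type) :
  infinite_set [set: T] -> [set: T * T] #<= [set: T].
Proof.
move=> Tinf.
have [F FP FT|G [GP Gmax]] := @Zorn_bigcup _ (@square_graph T).
  have dirF A B : F A -> F B -> exists2 C, F C & A `<=` C /\ B `<=` C.
    move=> FA FB; have [AB|BA] := FT _ _ FA FB; last by exists A; last split.
    by exists B; last split.
  have domF A : F A -> square_dom A `<=` square_dom (\bigcup_(X in F) X).
    by move=> FA a [c Ac]; exists c, A.
  split.
  - move=> u v [A FA Au] [B FB Bv].
    have [C FC [AC BC]] := dirF _ _ FA FB.
    by have [Cfun _ _] := FP _ FC; exact: Cfun (AC _ Au) (BC _ Bv).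
  - move=> a b c [A FA Aabc]; have [_ + _] := FP _ FA.
    by move=> /(_ _ _ _ Aabc)[? ? ?]; split; apply: (domF A).
  - move=> a b [c [A FA Ac]] [d [B FB Bd]].
    have [C FC [AC BC]] := dirF _ _ FA FB.
    have [_ _ /(_ a b)[||e Ce]] := FP _ FC.
    + by exists c; apply: AC.
    + by exists d; apply: BC.
    + by exists e, C.
have {}Gmax (I : Type) (e : I -> T) (pr : I * I -> I)
    (j : square_dom G -> I) (i0 i1 : I) : injective e ->
    (forall i, ~ square_dom G (e i)) -> injective pr -> injective j -> i0 = i1.
  move=> eI eD prI jI; apply: contrapT => i01.
  by have [G' /Gmax] := square_graph_extend GP eI eD prI jI i01.
set A := square_dom G in Gmax.
(* A finite: a copy of nat outside A would extend G *)
have [Afin|/infiniteP Ainf] := pselect (finite_set A).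
  have /infiniteP : infinite_set (~` A).
    move=> Cfin; apply: Tinf; rewrite -(setUv A).
    by rewrite finite_setU; split.
  rewrite -(card_le_eqr (card_setT _)) => /cardT_leP[e eI].
  have /finite_set_countable := Afin.
  rewrite /countable -(card_le_eql (card_setT _)) => /cardT_leP[j jI].
  have /cardT_leP[pr prI] : [set: nat * nat] #<= [set: nat].
    by have := card_nat2; rewrite card_eq_le => /andP[].
  suff : 0%N = 1%N by [].
  apply: (@Gmax nat (set_val \o e) pr j) => //; first by move=> x y /val_inj/eI.
  by move=> i; have := set_valP (e i).
move: Ainf; rewrite -(card_le_eqr (card_setT _)) => /cardT_leP[i iI].
have [_ Gdom Gtot] := GP; have [Gfun _ _] := GP.
have [pr prI] : exists pr : A * A -> A, injective pr.
  have /choice[pr prP] : forall u : A * A, exists c : A,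
      G (val u.1, val u.2, val c).
    move=> [a b] /=.
    have [c Gc] := Gtot _ _ (set_valP a) (set_valP b).
    have [_ _ Ac] := Gdom _ _ _ Gc.
    by exists (SigSub (mem_set Ac)).
  exists pr => -[a b] [c d] E.
  have /= := (Gfun _ _ (prP (a, b)) (prP (c, d))).2.
  by rewrite E => /(_ erefl)[/val_inj-> /val_inj->].
have [/cardT_leP[e eI]|/cardT_leP[e eI]] := cardT_le_total A (~` A).
  have : i 0%N = i 1%N.
    apply: (@Gmax A (set_val \o e) pr id) => //.
      by move=> x y /val_inj/eI.
    by move=> a; have := set_valP (e a).
  by move=> /iI.
have [k kI] : exists k : T -> A, injective k.
  pose k x := match pselect (A x) with
    | left Ax => pr (i 0%N, SigSub (mem_set Ax))
    | right nAx => pr (i 1%N, e (SigSub (mem_set (nAx : (~` A) x))))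
    end.
  exists k => x y; rewrite /k.
  case: pselect => [Ax|nAx]; case: pselect => [Ay|nAy] /prI.
  - by case.
  - by case=> /iI.
  - by case=> /iI.
  - by case=> /eI[].
apply/cardT_leP; exists (fun u => val (pr (k u.1, k u.2))).
by move=> [a b] [c d] /val_inj/prI[/= /kI-> /kI->].
Qed.

Lemma card_seq_le (T : Type) :
  infinite_set [set: T] -> [set: seq T] #<= [set: T].
Proof.
move=> Tinf; have /cardT_leP[pr prI] := card_square_le Tinf.
have [i iI] := infiniteT_natP Tinf.
apply/cardT_leP.
exists (fun s => pr (i (size s), foldr (fun x y => pr (x, y)) (i 0%N) s)).
move=> s t /prI[/iI]; elim: s t => [|x s IH] [|y t] //= [st].
by move=> /prI[-> /(IH _ st)->].
Qed.

(** Either X is at most M, hence so is [seq X], or X is infinite and [seq X] is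
    no larger than X. *)
Lemma card_seq_lt (M L X : Type) :
  infinite_set [set: M] -> card_lt [set: M] [set: L] ->
  ~ ([set: L] #<= [set: X]) -> ~ ([set: L] #<= [set: seq X]).
Proof.
move=> Minf [ML LM] LX LsX.
have [XM|MX] := cardT_le_total X M.
  apply: LM; apply: (card_le_trans LsX); apply: card_le_trans (card_seq_le Minf).
  have /cardT_leP[f fI] := XM.
  by apply/cardT_leP; exists (map f); apply: inj_map.
apply: LX; apply: (card_le_trans LsX); apply: card_seq_le.
by move=> Xfin; apply: Minf; apply: card_le_finite MX Xfin.
Qed.

(** * Well-orders *)

Section WellOrder.
Variables (L : Type) (R : rel L).
Hypothesis Rwo : well_order R.

Lemma wo_min (P : set L) : P !=set0 -> exists2 z, P z & forall y, P y -> R z y.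
Proof.
move=> [x Px]; have [|z [[zP zmin] _]] := Rwo (A := fun y => `[< P y >]).
  by exists x; apply/asboolP.
by exists z => [|y Py]; [apply/asboolP|apply: zmin; apply/asboolP].
Qed.

Lemma wo_total x y : R x y || R y x.
Proof.
have [|z [->|->] zmin] := @wo_min [set t | t = x \/ t = y]; first by exists x; left.
  by rewrite zmin//; right.
by rewrite zmin ?orbT//; left.
Qed.

Lemma wo_refl x : R x x. Proof. by have := wo_total x x; rewrite orbb. Qed.

Lemma wo_anti x y : R x y -> R y x -> x = y.
Proof.
move=> xy yx; have [|z [_ uz]] := Rwo (A := fun t => `[< t = x \/ t = y >]).
  by exists x; apply/asboolP; left.
by rewrite -(uz x) ?(uz y)//; split=> [|t /asboolP[]->];
  rewrite ?wo_refl//; apply/asboolP; [right|left].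
Qed.

Lemma wo_trans y x z : R x y -> R y z -> R x z.
Proof.
move=> xy yz.
have [|m mP mmin] := @wo_min [set t | t = x \/ t = y \/ t = z].
  by exists x; left.
have mx : R m x by apply: mmin; left.
have my : R m y by apply: mmin; right; left.
have mz : R m z by apply: mmin; right; right.
case: mP => [<-//|[mE|mE]]; subst m.
  by rewrite (wo_anti xy mx).
by rewrite (wo_anti yz my) in xy.
Qed.

(** As R is total, the negation of the converse is the strict order. *)
Definition slt x y := ~~ R y x.

Lemma slt_le x y : slt x y -> R x y.
Proof. by move=> xy; have := wo_total x y; rewrite (negbTE xy) orbF. Qed.

Lemma slt_le_trans y x z : slt x y -> R y z -> slt x z.
Proof. by move=> xy yz; apply/negP => zx; move/negP: xy; apply; apply: wo_trans zx. Qed.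

Lemma le_slt_trans y x z : R x y -> slt y z -> slt x z.
Proof. by move=> xy yz; apply/negP => zx; move/negP: yz; apply; apply: wo_trans xy. Qed.

Lemma sltP x y : reflect (R x y /\ x <> y) (slt x y).
Proof.
apply: (iffP idP) => [xy|[xy nxy]].
  by split=> [|e]; [exact: slt_le|move: xy; rewrite /slt e wo_refl].
by apply/negP => yx; apply: nxy; apply: wo_anti.
Qed.

Lemma slt_wf : well_founded slt.
Proof.
move=> x; apply: contrapT => nx.
have [|z nz zmin] := @wo_min [set z | ~ Acc slt z]; first by exists x.
by apply: nz; constructor => y; apply: contraPP => /zmin yz; apply/negP/negPn.
Qed.

Definition seg x := {y : L | slt y x}.

(** Transfinite construction where each value only has to be related to the
    set of the previous values. *)
Lemma wo_rec (X : Type) (Q : set X -> X -> Prop) :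
  (forall i (h : seg i -> X), exists x, Q (range h) x) ->
  exists g : L -> X, forall i, Q [set g k | k in [set k | slt k i]] (g i).
Proof.
move=> H.
pose s i h := sval (cid (H i h)).
have sP i h : Q (range h) (s i h) := svalP (cid (H i h)).
pose g := Fix slt_wf (fun=> X) (fun i rec => s i (fun k : seg i => rec (val k) (valP k))).
have gE i : g i = s i (fun k : seg i => g (val k)).
  rewrite /g Fix_eq// => x f f' ff'; congr s.
  by apply: funext => k; exact: ff'.
exists g => i.
suff -> : [set g k | k in [set k | slt k i]] = range (fun k : seg i => g (val k)).
  by rewrite gE; exact: sP.
apply/seteqP; split=> _ [k /= ki <-]; last first.
  by exists (val k) => //; exact: (valP k).
by exists (exist _ k ki).
Qed.

(** In a well-order every sequence is minorised by the nondecreasing sequence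
    of the minima of its tails; each of these is a later term, so if the n-th
    term encodes the first n values of [s], the tail minima still encode all
    of [s]. *)
Lemma monotone_code (M : Type) (c : set L) (t : M -> L) :
  infinite_set [set: M] -> injective t -> (forall m, c (t m)) ->
  exists W : (nat -> M) -> nat -> L,
    [/\ injective W, forall s n, c (W s n) &
        forall s m n, (m <= n)%N -> R (W s m) (W s n)].
Proof.
move=> Minf tI tc.
have /cardT_leP[e eI] := card_seq_le Minf.
have /choice[W WP] : forall s : nat -> M, exists W : nat -> L, forall N,
    (exists2 n, (N <= n)%N & W N = t (e (mkseq s n))) /\
    (forall n, (N <= n)%N -> R (W N) (t (e (mkseq s n)))).
  move=> s; suff /choice[W WP] : forall N, exists z,
      (exists2 n, (N <= n)%N & z = t (e (mkseq s n))) /\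
      (forall n, (N <= n)%N -> R z (t (e (mkseq s n)))) by exists W.
  move=> N.
  have [|z zP zmin] := @wo_min [set z | exists2 n, (N <= n)%N & z = t (e (mkseq s n))].
    by exists (t (e (mkseq s N))); exists N.
  by exists z; split=> // n Nn; apply: zmin; exists n.
exists W; split.
- move=> s s' E; apply: funext => k.
  have [[n kn Wn] _] := WP s k.+1; have [[n' kn' Wn'] _] := WP s' k.+1.
  have := Wn; rewrite E Wn' => /tI/eI es.
  have en : n' = n by have := congr1 size es; rewrite !size_mkseq.
  by have := congr1 (fun r => nth (s k) r k) es; rewrite en !nth_mkseq ?en.
- by move=> s n; have [[k _ ->] _] := WP s n.
- move=> s m n mn; have [[k nk ->] _] := WP s n.
  by have [_] := WP s m; apply; apply: leq_trans nk.
Qed.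

End WellOrder.

(** * Weak club guessing *)

Section ClubGuessing.
Variables (L M : Type) (R : rel L).
Hypothesis Rwo : well_order R.
Local Notation lt := (slt R).
Local Notation seg := (seg R).

Hypothesis Lini : forall x, ~ ([set: L] #<= [set: seg x]).
Hypothesis Lreg : forall (X : Type) (h : X -> L),
  ~ ([set: L] #<= [set: X]) -> exists b, forall x, lt (h x) b.
Hypothesis Minf : infinite_set [set: M].
Hypothesis ML : card_lt [set: M] [set: L].

Let Lunc : ~ ([set: L] #<= [set: nat]).
Proof.
by move=> Ln; case: ML => _; apply; apply: card_le_trans Ln _; apply/infiniteP.
Qed.

Lemma succ_exists x : exists y, lt x y.
Proof.
have [|b bP] := @Lreg unit (fun=> x); last by exists b; apply: bP tt.
move=> Lu; apply: Lunc; apply: card_le_trans Lu _.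
by apply/cardT_leP; exists (fun=> 0%N) => -[] [].
Qed.

Lemma bound_le x (h : L -> L) : exists b, forall z, R z x -> lt (h z) b.
Proof.
have [y xy] := succ_exists x.
have [b bP] := @Lreg (seg y) (h \o val) (@Lini y).
by exists b => z zx; apply: (bP (exist _ z (le_slt_trans Rwo zx xy))).
Qed.

Lemma max_exists x y : exists z, R x z /\ R y z.
Proof.
have := wo_total Rwo x y => /orP[xy|yx]; [exists y|exists x];
  by split=> //; exact: wo_refl.
Qed.

(** In a regular uncountable cardinal, every closed unbounded set contains the
    closure points of some [phi], apart from the least element, which is one
    vacuously. So guessing these is guessing clubs; and fewer than |L| functions
    have a common upper bound, which replaces the intersection of clubs. *)
Definition closed_under (phi : L -> L) : set L :=
  [set a | forall b, lt b a -> lt (phi b) a].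

Lemma closed_under_anti (phi psi : L -> L) :
  (forall b, R (phi b) (psi b)) -> closed_under psi `<=` closed_under phi.
Proof.
by move=> le a ca b ba; apply: le_slt_trans (le b) (ca _ ba).
Qed.

(** The limit of countably many steps, each going past the values of [phi]
    on everything below the previous one. *)
Lemma closed_unbounded phi b : exists2 c, closed_under phi c & lt b c.
Proof.
have /choice[next nextP] : forall x, exists y, lt x y /\ forall z, R z x -> lt (phi z) y.
  move=> x; have [y xy] := succ_exists x; have [b' b'P] := bound_le x phi.
  have [m [ym bm]] := max_exists y b'.
  exists m; split=> [|z zx]; first exact: slt_le_trans ym.
  by apply: slt_le_trans bm => //; exact: b'P.
pose g n := iter n next b.
have gS n : g n.+1 = next (g n) by [].
have [B BP] := @Lreg nat g Lunc.
have [|c cP cmin] := @wo_min _ _ Rwo [set c | forall n, lt (g n) c]; first by exists B.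
exists c => [z zc|]; last exact: (cP 0%N).
have [n] : exists n, R z (g n).
  apply: contrapT => nz; move/negP: zc; apply; apply: cmin => n.
  by apply/negP => zn; apply: nz; exists n.
have [_ /[apply]] := nextP (g n); rewrite -gS => h.
exact: slt_le_trans (slt_le Rwo (cP n.+1)).
Qed.

(** The supremum of the closure points below [a] is a closure point; the
    least element of L is one vacuously, so there is no empty case. *)
Lemma closed_floor_exists phi a : exists c, [/\ closed_under phi c, R c a &
  forall e, closed_under phi e -> R e a -> R e c].
Proof.
have [|c cP cmin] := @wo_min _ _ Rwo
  [set c | forall e, closed_under phi e -> R e a -> R e c].
  by exists a.
exists c; split=> // [b bc|]; last exact: cmin.
have [e [ec ea be]] : exists e, [/\ closed_under phi e, R e a & lt b e].
  apply: contrapT => ne; move/negP: bc; apply; apply: cmin => e ec ea.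
  by apply: contrapT => /negP be; apply: ne; exists e.
by apply: slt_le_trans (cP _ ec ea) => //; exact: ec.
Qed.

Definition closed_floor phi a := sval (cid (closed_floor_exists phi a)).

Lemma closed_floorP phi a : [/\ closed_under phi (closed_floor phi a),
  R (closed_floor phi a) a &
  forall e, closed_under phi e -> R e a -> R e (closed_floor phi a)].
Proof. exact: svalP (cid (closed_floor_exists phi a)). Qed.

Lemma closed_floor_anti (phi psi : L -> L) a : (forall b, R (phi b) (psi b)) ->
  R (closed_floor psi a) (closed_floor phi a).
Proof.
move=> le; have [c1 c2 _] := closed_floorP psi a.
have [_ _] := closed_floorP phi a; apply=> //.
exact: closed_under_anti le _ c1.
Qed.

(** The point [w] stands for the ordinal |M|^+, so that the whole argument takes
    place in the well-order of L. *)
Lemma successor_point : (exists x, ~ ([set: seg x] #<= [set: M])) ->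
  exists w, ~ ([set: seg w] #<= [set: M]) /\
            forall x, lt x w -> [set: seg x] #<= [set: M].
Proof.
move=> H; have [w wP wmin] := @wo_min _ _ Rwo [set x | ~ ([set: seg x] #<= [set: M])] H.
exists w; split=> // x; apply: contraPP => /wmin wx.
by apply/negP/negPn.
Qed.

(** Regularity of |M|^+: if the values of [h] were unbounded below [w], the
    segment of [w] would be a union of |M| sets of size at most |M|, and its
    elements could be coded by sequences of length at most two. *)
Lemma successor_regular w (X : Type) (h : X -> L) :
  ~ ([set: seg w] #<= [set: M]) ->
  (forall x, lt x w -> [set: seg x] #<= [set: M]) ->
  [set: X] #<= [set: M] -> (forall x, lt (h x) w) ->
  exists2 b, lt b w & forall x, lt (h x) b.
Proof.
move=> wM wmin /cardT_leP[i iI] hw; apply: contrapT => nb.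
have {}nb b : lt b w -> exists x, R b (h x).
  move=> bw; apply: contrapT => nx; apply: nb; exists b => // x.
  by apply/negP => bx; apply: nx; exists x.
apply: wM; apply: card_le_trans (card_seq_le Minf); apply/cardT_leP.
have g_ x : exists g : seg (h x) -> M, injective g by apply/cardT_leP/wmin.
pose g x := sval (cid (g_ x)).
have gI x : injective (g x) := svalP (cid (g_ x)).
have /choice[f fP] : forall b : seg w, exists s : seq M, exists x,
    (val b = h x /\ s = [:: i x]) \/
    (exists k : seg (h x), val b = val k /\ s = [:: i x; g x k]).
  move=> b; have [x bx] := nb _ (valP b).
  have [e|ne] := pselect (val b = h x); first by exists [:: i x], x; left.
  have k : lt (val b) (h x) by apply/(sltP Rwo).
  pose k' : seg (h x) := exist (fun y => lt y (h x)) (val b) k.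
  by exists [:: i x; g x k'], x; right; exists k'.
exists f => b b' E; apply: val_inj; have [x [[bx sx]|[k [bk sk]]]] := fP b;
  have [x' [[bx' sx']|[k' [bk' sk']]]] := fP b'.
- by move: sx; rewrite E sx' bx bx' => -[/iI->].
- by move: sx; rewrite E sk'.
- by move: sk; rewrite E sx'.
- move: sk; rewrite E sk' => -[/iI xx]; subst x' => /gI kk.
  by rewrite bk bk' kk.
Qed.

Lemma bounding_exists (X : Type) (h : X -> L -> L) :
  ~ ([set: L] #<= [set: X]) -> exists f, forall x b, R (h x b) (f b).
Proof.
move=> LX; suff /choice[f fP] : forall b, exists y, forall x, R (h x b) y.
  by exists f.
move=> b; have [y yP] := @Lreg _ (h^~ b) LX.
by exists y => x; exact: slt_le.
Qed.

(** Fix for each d a cofinal map [lad d] from [w] to d when there is one,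
    and for a function phi let [F phi d j] be the set of closure points of phi
    nearest below the first j points of [lad d]. Some phi works. Otherwise each
    phi is defeated by some [Phi phi], and iterating gives an increasing chain
    [psi i], i < w. Let d be a limit of |M|^+ common closure points. For a fixed
    k, the closure point of [psi i] nearest below [lad d k] decreases with i, so
    it is eventually a constant [v k]. The values of v are cofinal in d, so
    |M| of them occur among the k below some j < w, and by regularity of |M|^+
    all of those k have stabilised by some stage i < w. At that stage
    [F (psi i) d j] is large and consists of closure points of the later
    functions of the chain, among them [Phi (psi i)]: a contradiction. *)
Theorem weak_club_guessing : (exists x, ~ ([set: seg x] #<= [set: M])) ->
  exists F : L -> L -> set L, forall phi, exists d j,
    (exists2 t : M -> L, injective t & forall m, F d j (t m)) /\
    F d j `<=` closed_under phi.
Proof.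
move=> /successor_point[w [wM wmin]].
have wreg X h := @successor_regular w X h wM wmin.
pose cofseq d l := (forall j, lt j w -> lt (l j) d) /\
  (forall b, lt b d -> exists2 j, lt j w & R b (l j)).
have /choice[lad ladP] : forall d, exists l, (exists l', cofseq d l') -> cofseq d l.
  move=> d; have [[l lP]|nl] := pselect (exists l, cofseq d l); first by exists l.
  (* default when d is not the supremum of a w-sequence *)
  by exists id.
pose F phi d j := [set closed_floor phi (lad d k) | k in [set k | lt k j]].
apply: contrapT => noF.
have /choice[Phi PhiP] : forall phi, exists phi', forall d j,
    (exists2 t : M -> L, injective t & forall m, F phi d j (t m)) ->
    ~ (F phi d j `<=` closed_under phi').
  move=> phi; apply: contrapT => nphi; apply: noF; exists (F phi) => phi'.
  apply: contrapT => nd; apply: nphi; exists phi' => d j tP sub.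
  by apply: nd; exists d, j.
have [psi psiP] : exists psi : L -> L -> L, forall i,
    forall f, [set psi k | k in [set k | lt k i]] f ->
    forall b, R (f b) (psi i b) /\ R (Phi f b) (psi i b).
  apply: (wo_rec Rwo (Q := fun A x => forall f, A f ->
    forall b, R (f b) (x b) /\ R (Phi f b) (x b))) => i h.
  have [f fP] := @bounding_exists _ h (@Lini i).
  have [f' f'P] := @bounding_exists _ (Phi \o h) (@Lini i).
  have /choice[x xP] : forall b, exists z, R (f b) z /\ R (f' b) z.
    by move=> b; exact: max_exists.
  exists x => _ [k _ <-] b; have [fx f'x] := xP b.
  by split; [apply: (wo_trans Rwo) fx; exact: fP|apply: (wo_trans Rwo) f'x; exact: f'P].
have {}psiP k i : lt k i -> forall b,
    R (psi k b) (psi i b) /\ R (Phi (psi k) b) (psi i b).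
  by move=> ki b; apply: psiP; exists k.
pose fl i a := closed_floor (psi i) a.
have [eps epsP] : exists eps : L -> L, forall i, closed_under (psi w) (eps i) /\
    forall a, [set eps k | k in [set k | lt k i]] a -> lt a (eps i).
  apply: (wo_rec Rwo (Q := fun A x => closed_under (psi w) x /\
    forall a, A a -> lt a x)) => i h.
  have [b bP] := @Lreg _ h (@Lini i).
  have [c cc bc] := closed_unbounded (psi w) b.
  exists c; split=> // _ [k _ <-].
  exact: slt_le_trans (bP k) (slt_le Rwo bc).
have eps_closed k : closed_under (psi w) (eps k) by have [] := epsP k.
have {}epsP k i : lt k i -> lt (eps k) (eps i).
  by have [_ h] := epsP i; move=> ki; apply: h; exists k.
have [|d dP dmin] := @wo_min _ _ Rwo [set d | forall k, lt k w -> lt (eps k) d].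
  by exists (eps w) => k; exact: epsP.
have [ladd ladcof] : cofseq d (lad d).
  apply: ladP; exists eps; split=> // b bd; apply: contrapT => nb.
  move/negP: bd; apply; apply: dmin => k kw.
  by apply/negP => bk; apply: nb; exists k.
have psi_mono k i : R k i -> forall b, R (psi k b) (psi i b).
  move=> ki b; have [<-|ne] := pselect (k = i); first exact: wo_refl.
  by have [] := psiP k i _ b; first by apply/(sltP Rwo).
have fl_anti k i a : R k i -> R (fl i a) (fl k a).
  by move=> ki; apply: closed_floor_anti; exact: psi_mono.
have [i0 i0w] : exists i0, lt i0 w.
  apply: contrapT => nw; apply: wM; apply/cardT_leP.
  have [m _] := infiniteT_natP Minf.
  by exists (fun=> m 0%N) => -[x xw]; exfalso; apply: nw; exists x.
have /choice[v /choice[iv ivP]] : forall j, exists z i, [/\ lt i w,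
    z = fl i (lad d j) & forall i', lt i' w -> R z (fl i' (lad d j))].
  move=> j; have [|_ [i iw <-] zmin] := @wo_min _ _ Rwo
    [set fl i (lad d j) | i in [set i | lt i w]].
    by exists (fl i0 (lad d j)); exists i0.
  by exists (fl i (lad d j)), i; split=> // i' i'w; apply: zmin; exists i'.
have vE j i : R (iv j) i -> lt i w -> fl i (lad d j) = v j.
  move=> ji iw; have [ivw vj vmin] := ivP j.
  by apply: (wo_anti Rwo); [rewrite vj; exact: fl_anti|exact: vmin].
have v_lad j : R (v j) (lad d j).
  by have [_ -> _] := ivP j; have [] := closed_floorP (psi (iv j)) (lad d j).
have v_eps j k : R (eps k) (lad d j) -> R (eps k) (v j).
  move=> kj; have [ivw -> _] := ivP j.
  have [_ _] := closed_floorP (psi (iv j)) (lad d j); apply=> //.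
  by apply: closed_under_anti (eps_closed k); apply: psi_mono; exact: slt_le.
(* the set of stable values; being cofinal in d, it is larger than M *)
pose V := {z : L | `[< exists2 j, lt j w & z = v j >]}.
have VP (z : V) : exists2 j, lt j w & val z = v j := asboolW (valP z).
have [/cardT_leP[t tI]|VM] := cardT_le_total M V; last first.
  have /choice[k kP] : forall z : V, exists k, lt k w /\ R (val z) (eps k).
    move=> z; have [j jw zj] := VP z; apply: contrapT => nk.
    have : lt (v j) d by apply: le_slt_trans (v_lad j) (ladd _ jw).
    move/negP; apply; apply: dmin => k kw.
    by apply/negP => vk; apply: nk; exists k; rewrite zj.
  have [k' k'w kk'] := wreg _ k VM (fun z => (kP z).1).
  have [j jw jk'] := ladcof _ (dP _ k'w).
  have zP : `[< exists2 j', lt j' w & v j = v j' >] by apply/asboolP; exists j.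
  pose z : V := exist _ (v j) zP.
  have := le_slt_trans Rwo (kP z).2 (epsP _ _ (kk' z)).
  by move/negP; apply; exact: v_eps.
have /choice[J JP] : forall m, exists j, lt j w /\ val (t m) = v j.
  by move=> m; have [j] := VP (t m); exists j.
have [j jw Jj] := wreg _ J (card_lexx _) (fun m => (JP m).1).
have [i iw ivi] : exists2 i, lt i w & forall k : seg j, lt (iv (val k)) i.
  by apply: (wreg (seg j)) => [|k]; [exact: wmin|have [] := ivP (val k)].
have [i' i'w ii'] : exists2 i', lt i' w & forall m : M, lt i i'.
  exact: (wreg M).
have {}ii' : lt i i' by have [m _] := infiniteT_natP Minf; exact: ii' (m 0%N).
have Fv k : lt k j -> closed_floor (psi i) (lad d k) = v k.
  move=> kj; apply: vE => //; apply: slt_le => //.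
  exact: (ivi (exist _ k kj)).
have Fv' k : lt k j -> fl i' (lad d k) = v k.
  move=> kj; apply: vE => //; apply: slt_le => //.
  by apply: slt_le_trans (ivi (exist _ k kj)) (slt_le Rwo ii').
apply: (PhiP (psi i) d j).
  exists (fun m => val (t m)) => [m m' /val_inj/tI//|m].
  by exists (J m); [exact: Jj|rewrite Fv ?(JP m).2].
move=> _ [k kj <-]; rewrite Fv// -(Fv' _ kj).
have [c _ _] := closed_floorP (psi i') (lad d k).
by apply: closed_under_anti c => b; have [] := psiP _ _ ii' b.
Qed.

End ClubGuessing.

(** * Regular cardinals as well-orders *)

(** An unbounded family would have a cofinal range. *)
Lemma regular_bounded (L : Type) (R : rel L) (X : Type) (h : X -> L) :
  well_order R -> (forall A : set L, cofinal R A -> [set: L] #<= A) ->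
  ~ ([set: L] #<= [set: X]) -> exists b, forall x, slt R (h x) b.
Proof.
move=> Rwo Rcof LX; apply: contrapT => nb; apply: LX.
have /card_le_trans : [set: L] #<= range h.
  apply: Rcof => x; apply: contrapT => nx; apply: nb; exists x => k.
  by apply/negP => xk; apply: nx; exists (h k) => //; exists k.
by apply; exact: card_image_le.
Qed.

Lemma initial_seg_lt (L : Type) (R : rel L) :
  initial_well_order R -> forall x, ~ ([set: L] #<= [set: seg R x]).
Proof.
move=> [Rwo Rini] x Lx; have [_] := Rini x; apply.
apply: (card_le_trans Lx).
rewrite -(card_le_eqr (card_setT _)); apply/cardT_leP.
have segA (y : seg R x) : [set y | R y x /\ y <> x] (val y).
  exact/(sltP Rwo)/(valP y).
exists (fun y => SigSub (mem_set (segA y))).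
by move=> y z [/val_inj].
Qed.

(** A bounded copy of S in L lies in a segment, which is then larger than M. *)
Lemma seg_between (L S M : Type) (R : rel L) :
  (forall h : S -> L, exists b, forall x, slt R (h x) b) ->
  [set: S] #<= [set: L] -> ~ ([set: S] #<= [set: M]) ->
  exists x, ~ ([set: seg R x] #<= [set: M]).
Proof.
move=> Sbd /cardT_leP[h hI] SM; have [b bP] := Sbd h.
exists b => bM; apply: SM; apply: card_le_trans bM; apply/cardT_leP.
exists (fun x => exist (fun y => slt R y b) (h x) (bP x)).
by move=> x y [/hI].
Qed.

Local Open Scope ring_scope.

(** * Products of cyclic groups *)

Definition dep_prod (V : nat -> zmodType) := forall n, V n.

Section DepProd.
Variable V : nat -> zmodType.
Implicit Types x y z : dep_prod V.

HB.instance Definition _ := gen_eqMixin (dep_prod V).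
HB.instance Definition _ := gen_choiceMixin (dep_prod V).

Let add x y : dep_prod V := fun n => x n + y n.
Let opp x : dep_prod V := fun n => - x n.
Let zero : dep_prod V := fun n => 0.

Let addA : associative add.
Proof. by move=> x y z; apply: functional_extensionality_dep => n; exact: addrA. Qed.
Let addC : commutative add.
Proof. by move=> x y; apply: functional_extensionality_dep => n; exact: addrC. Qed.
Let add0 : left_id zero add.
Proof. by move=> x; apply: functional_extensionality_dep => n; exact: add0r. Qed.
Let addN : left_inverse zero opp add.
Proof. by move=> x; apply: functional_extensionality_dep => n; exact: addNr. Qed.

HB.instance Definition _ := GRing.isZmodule.Build (dep_prod V) addA addC add0 addN.

Lemma dep_prodD x y n : (x + y) n = x n + y n. Proof. by []. Qed.
Lemma dep_prodB x y n : (x - y) n = x n - y n. Proof. by []. Qed.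
Lemma dep_prodMn x k n : (x *+ k) n = x n *+ k.
Proof. by elim: k => // k IH; rewrite !mulrS dep_prodD IH. Qed.

End DepProd.

(** * Subgroups given by generators *)

Section GeneratedGroup.
Variables (V : zmodType) (I : Type) (v : I -> V).

(** Signs suffice as coefficients, since a generator may be repeated; this
    keeps the number of expressions easy to bound. *)
Definition signed_sum (q : seq (bool * I)) : V :=
  \sum_(u <- q) (if u.1 then - v u.2 else v u.2).

Definition generated_pred : {pred V} := fun z => `[< exists q, z = signed_sum q >].

Lemma generated_zmod_closed : zmod_closed generated_pred.
Proof.
split=> [|x y]; first by apply/asboolP; exists [::]; rewrite /signed_sum big_nil.
rewrite !unfold_in => /asboolP[q ->] /asboolP[r ->]; apply/asboolP.
exists (q ++ [seq (~~ u.1, u.2) | u <- r]).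
rewrite /signed_sum big_cat big_map /= -sumrN; congr (_ + _).
by apply: eq_bigr => -[[] i] _ //=; rewrite opprK.
Qed.

HB.instance Definition _ :=
  GRing.isZmodClosed.Build V generated_pred generated_zmod_closed.

Definition generated_group := {z : V | z \in generated_pred}.
HB.instance Definition _ := Choice.on generated_group.
HB.instance Definition _ := SubType.on generated_group.
HB.instance Definition _ := [SubChoice_isSubZmodule of generated_group by <:].

Lemma generated_mem i : v i \in generated_pred.
Proof.
by apply/asboolP; exists [:: (false, i)]; rewrite /signed_sum big_seq1.
Qed.

Definition generator i : generated_group := exist _ (v i) (generated_mem i).

Lemma generated_ind (Q : V -> Prop) : Q 0 -> (forall x y, Q x -> Q y -> Q (x - y)) ->
  (forall i, Q (v i)) -> forall z : generated_group, Q (val z).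
Proof.
move=> Q0 QB Qv z; have /asboolP[q ->] := valP z.
have QN x : Q x -> Q (- x) by move=> Qx; rewrite -sub0r; exact: QB.
rewrite /signed_sum; elim/big_rec : _ => // -[b i] x _ Qx.
by rewrite -(opprK x); apply: QB; [case: b => //=; exact: QN|exact: QN].
Qed.

Lemma card_generated_le : [set: generated_group] #<= [set: seq (bool * I)].
Proof.
apply/cardT_leP.
have /choice[q qP] (z : generated_group) : exists q, val z = signed_sum q :=
  asboolW (valP z).
by exists q => x y xy; apply: val_inj; rewrite /= qP xy -qP.
Qed.

End GeneratedGroup.

(** * Unit vectors and tails of the infinite sums *)

Section Coordinates.
Variables (p : nat) (L : Type).
Hypothesis pp : prime p.

Definition torsion_prod := dep_prod (fun n => L -> 'Z_(p ^ n.+1) : zmodType).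
HB.instance Definition _ := GRing.Zmodule.on torsion_prod.

Definition unit_vec (n : nat) (a : L) : torsion_prod :=
  fun i c => ((i == n) && `[< c = a >])%:R.

(** Formally the sum over i >= k of p^(i - k) e(i, s i): the tail from k on
    of the infinite sum attached to [s], divided by p^k. *)
Definition tail_sum (s : nat -> L) (k : nat) : torsion_prod :=
  fun i c => (((k <= i)%N && `[< c = s i >]) * p ^ (i - k))%:R.

Lemma expp_gt1 n : (1 < p ^ n.+1)%N.
Proof. by rewrite -(exp1n n.+1) ltn_exp2r// prime_gt1. Qed.

Lemma torsion_prodMn (x : torsion_prod) k i c : (x *+ k) i c = x i c *+ k.
Proof.
rewrite dep_prodMn; elim: k => // k IH; rewrite !mulrS -IH //.
Qed.

(** The coordinate i lives in a group killed by p^(i+1), so divisibility by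
    p^m is visible on the first m coordinates. *)
Lemma torsion_coord (x : torsion_prod) i c m : (i < m)%N -> (x *+ p ^ m) i c = 0.
Proof.
move=> im; rewrite torsion_prodMn -mulr_natr -(subnKC im) expnD natrM.
by rewrite pchar_Zp ?expp_gt1// mul0r mulr0.
Qed.

Lemma tail_sumS s k : tail_sum s k = unit_vec k (s k) + tail_sum s k.+1 *+ p.
Proof.
apply: functional_extensionality_dep => i; apply: funext => c.
rewrite dep_prodD /GRing.add/= torsion_prodMn /tail_sum /unit_vec -mulrnA -natrD.
have [ik|ki|<-] := ltngtP i k; first by [].
  by rewrite add0n -mulnA -expnSr subnSK.
by rewrite subnn expn0 muln1 mul0n addn0.
Qed.

Lemma tail_sum_expansion s m :
  tail_sum s 0 = \sum_(i < m) unit_vec i (s i) *+ p ^ i + tail_sum s m *+ p ^ m.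
Proof.
elim: m => [|m IH]; first by rewrite big_ord0 add0r expn0 mulr1n.
by rewrite IH tail_sumS mulrnDl big_ord_recr /= addrA expnS mulrnA.
Qed.

Lemma tail_sum_coord s i : tail_sum s 0 i (s i) != 0.
Proof.
rewrite /tail_sum leq0n asboolT// mul1n subn0.
rewrite -(inj_eq val_inj) /= val_Zp_nat ?expp_gt1// modn_small.
  by rewrite -lt0n expn_gt0 prime_gt0.
by rewrite ltn_exp2l// prime_gt1.
Qed.

Lemma unit_vec_inj : injective (unit_vec 0).
Proof.
move=> a b /(congr1 (fun x => x 0%N a)); rewrite /unit_vec /= asboolT//.
by case: asboolP.
Qed.

Lemma unit_vec_torsion n a : unit_vec n a *+ p ^ n.+1 = 0.
Proof.
apply: functional_extensionality_dep => i; apply: funext => c.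
rewrite torsion_prodMn /unit_vec; have [<-|] := eqVneq i n; last by rewrite mul0rn.
by rewrite -[LHS]mulr_natr pchar_Zp ?expp_gt1// mulr0.
Qed.

Lemma tail_sum_torsion s k : tail_sum s k *+ p ^ k.+1 = 0.
Proof.
apply: functional_extensionality_dep => i; apply: funext => c.
rewrite torsion_prodMn /tail_sum; have [ki|] := leqP k i; last by rewrite mul0n mul0rn.
rewrite -mulrnA -mulnA -expnD addnS subnK// mulnC natrM.
by rewrite pchar_Zp ?expp_gt1// mul0r.
Qed.

End Coordinates.

(** By Bezout, the least power of p killing x is its order: any smaller
    annihilator k would give gcd (k, p^n) = p^i with i < n. *)
Lemma p_torsion_group (p : nat) (G : zmodType) : prime p ->
  (forall x : G, exists k, x *+ p ^ k = 0) -> abelian_p_group p G.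
Proof.
move=> pp tor x x0; have ex : exists k, x *+ p ^ k == 0.
  by have [k /eqP] := tor x; exists k.
case: (ex_minnP ex) => n /eqP xn nmin; exists n; split=> //.
  by rewrite expn_gt0 prime_gt0.
move=> k /andP[k0 kn] xk.
have [i ik gE] : exists2 i, (i <= n)%N & gcdn k (p ^ n)%N = (p ^ i)%N.
  exact/(dvdn_pfactor _ _ pp)/dvdn_gcdr.
have [u _ /dvdnP[w uw]] := Bezoutl (p ^ n)%N k0.
have xi : x *+ p ^ i = 0.
  have : x *+ (gcdn k (p ^ n) + u * p ^ n)%N = 0 by rewrite uw mulnC mulrnA xk mul0rn.
  by rewrite mulrnDr mulnC mulrnA xn mul0rn addr0 gE.
have := nmin _ (introT eqP xi); rewrite leqNgt => /negP; apply.
rewrite -(ltn_exp2l _ _ (prime_gt1 pp)) -gE; apply: leq_ltn_trans kn.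
exact/dvdn_leq/dvdn_gcdl.
Qed.

(** * The test group and its traces *)

(** If every nondecreasing sequence of points of c were described by some u,
    then u would determine it, as comparing [a m] with the points of c, the
    [a m] among them, determines [a m]. So U would be at least as large as the
    set of these sequences, hence as [nat -> M]. *)
Lemma avoiding_sequence (L M U : Type) (R : rel L) (c : set L) (t : M -> L)
    (tr : U -> L -> nat -> Prop) :
  well_order R -> infinite_set [set: M] -> ~ ([set: nat -> M] #<= [set: U]) ->
  injective t -> (forall m, c (t m)) ->
  exists a : nat -> L, [/\ forall n, c (a n),
    forall m n, (m <= n)%N -> R (a m) (a n) &
    forall u, ~ (forall x, c x -> forall m, tr u x m <-> slt R (a m) x)].
Proof.
move=> Rwo Minf MU tI tc.
have [W [WI Wc Wmono]] := monotone_code Rwo Minf tI tc.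
apply: contrapT => noa; apply: MU; apply/cardT_leP.
have /choice[u uP] : forall s, exists u, forall x, c x -> forall m,
    tr u x m <-> slt R (W s m) x.
  move=> s; apply: contrapT => nu; apply: noa; exists (W s); split=> // [|u uP].
    exact: Wmono.
  by apply: nu; exists u.
exists u => s s' E; apply: WI.
have le r r' m : u r = u r' -> R (W r m) (W r' m).
  move=> urr; apply: contrapT => /negP lt'.
  have := (uP r _ (Wc r m) m).1; rewrite urr => /(_ ((uP r' _ (Wc r m) m).2 lt')).
  by rewrite /slt wo_refl.
by apply: funext => m; apply: (wo_anti Rwo); apply: le.
Qed.

Section TestGroup.
Variables (p : nat) (L : Type) (A : L -> L -> nat -> L).
Hypothesis pp : prime p.

(** The flag selects between unit vectors, each listed once for every [d], and
    tails; a single index type makes the generators easy to count. *)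
Definition test_gen (i : bool * nat * L * L) : torsion_prod p L :=
  let: (b, n, c, d) := i in if b then unit_vec p n c else tail_sum p (A c d) n.

Local Notation test_group := (generated_group test_gen).

Definition test_unit n a : test_group := generator test_gen (true, n, a, a).
Definition test_tail c d k : test_group := generator test_gen (false, k, c, d).
Definition partial_sum (s : nat -> L) m : test_group :=
  \sum_(i < m) test_unit i (s i) *+ p ^ i.

Lemma test_tail_expansion c d m :
  test_tail c d 0 = partial_sum (A c d) m + test_tail c d m *+ p ^ m.
Proof.
apply: val_inj; rewrite raddfD raddfMn raddf_sum.
rewrite [LHS](tail_sum_expansion p (A c d) m); congr (_ + _).
by apply: eq_bigr => i _; rewrite raddfMn.
Qed.

Lemma test_group_torsion : abelian_p_group p test_group.
Proof.
apply: p_torsion_group => // x.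
suff [k xk] : exists k, val x *+ p ^ k = 0.
  by exists k; apply: val_inj; rewrite raddfMn xk raddf0.
apply: (generated_ind (Q := fun x => exists k, x *+ p ^ k = 0)) => [|y z|].
- by exists 0%N; rewrite mul0rn.
- move=> [k yk] [l zl]; exists (k + l)%N.
  by rewrite mulrnBl expnD mulrnA yk mulnC mulrnA zl !mul0rn subrr.
- move=> [[[[] n] c] d]; exists n.+1; first exact: unit_vec_torsion.
  exact: tail_sum_torsion.
Qed.

(** Generators have countable support, and regularity bounds it. *)
Lemma test_group_support (l0 : L) (R : rel L) : well_order R ->
  (forall h : nat -> L, exists b, forall n, slt R (h n) b) ->
  forall x : test_group, exists b, forall n a, val x n a <> 0 -> slt R a b.
Proof.
move=> Rwo bd x; apply: (generated_ind (Q := fun x : torsion_prod p L =>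
  exists b, forall n a, x n a <> 0 -> slt R a b)) => [|y z [b bP] [c cP]|].
- by exists l0.
- exists (if R b c then c else b) => n a yz.
  have [/bP ab|/contrapT y0] := pselect (y n a <> 0).
    by case: ifPn => // bc; exact: slt_le_trans bc.
  have /cP ac : z n a <> 0.
    move=> z0; apply: yz.
    by rewrite dep_prodB /GRing.add /= y0 [X in _ + X]/GRing.opp/= z0 subr0.
  by case: ifPn => // /(slt_le Rwo)/(slt_le_trans Rwo ac).
- move=> [[[[] n] c] d] /=; last first.
    have [b bP] := bd (A c d); exists b => i a.
    rewrite /tail_sum; case: asboolP => [-> _|_]; first exact: bP.
    by rewrite andbF.
  have [b bP] := bd (fun=> c); exists b => i a.
  rewrite /unit_vec; case: asboolP => [-> _|_]; first exact: (bP 0%N).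
  by rewrite andbF.
Qed.

Lemma card_test_group : infinite_set [set: L] -> [set: test_group] #= [set: L].
Proof.
move=> Linf; have [i iI] := infiniteT_natP Linf.
rewrite card_eq_le; apply/andP; split; last first.
  apply/cardT_leP; exists (test_unit 0) => a b /(congr1 val) /=.
  exact: unit_vec_inj.
apply: card_le_trans (card_generated_le test_gen) _.
apply: card_le_trans (card_seq_le Linf).
have Linf' : infinite_set [set: seq L].
  apply/infiniteP/cardT_leP; exists (fun n => [:: i n]) => m n [].
  exact: iI.
apply: card_le_trans (card_seq_le Linf').
have /cardT_leP[e eI] : [set: bool * (bool * nat * L * L)] #<= [set: seq L].
  apply/cardT_leP.
  exists (fun u => let: (e, (b, n, c, d)) := u in
    [:: i (nat_of_bool e); i (nat_of_bool b); i n; c; d]).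
  move=> [e [[[b n] c] d]] [e' [[[b' n'] c'] d']] [/iI + /iI + /iI -> -> ->].
  by case: e e' b b' => -[] [] [].
by apply/cardT_leP; exists (map e); exact: inj_map.
Qed.

End TestGroup.
Arguments test_gen p {L} A.
Arguments test_unit p {L} A.
Arguments test_tail p {L} A.
Arguments partial_sum p {L} A.
Notation test_group p A := (generated_group (test_gen p A)).

(** The stage at which u enters the closure of the elements enumerated so
    far, measured in the p-adic topology to precision p^(m+1). Precision p^0
    would carry no information. *)
Definition trace (p : nat) (L : Type) (R : rel L) (U : zmodType) (g : U -> L)
    (u : U) (x : L) (m : nat) : Prop :=
  exists u' v, slt R (g u') x /\ u - u' = v *+ p ^ m.+1.

Section Trace.
Variables (p : nat) (L M : Type) (R : rel L).
Hypotheses (pp : prime p) (Rwo : well_order R).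
Hypothesis Lini : forall x, ~ ([set: L] #<= [set: seg R x]).
Hypothesis Lreg : forall (X : Type) (h : X -> L),
  ~ ([set: L] #<= [set: X]) -> exists b, forall x, slt R (h x) b.
Hypothesis Minf : infinite_set [set: M].
Hypothesis ML : card_lt [set: M] [set: L].

Variables (A : L -> L -> nat -> L) (U : zmodType) (g : U -> L).
Hypothesis gI : injective g.
Variable f : {additive test_group p A -> U}.
Hypothesis fpure : pure_embedding f.

(** Write N for the test group, t for [test_tail p A c d 0] and a for [A c d].
    [phi] makes x catch up on two counts. Whenever u is enumerated before x and
    is congruent modulo p^(m+1) to the image of some element of N, it is
    congruent to the image of one supported below x; and the finite sums of
    the p^n e(n, s n) with all s n < x have images enumerated before x. If
    a_m < x, the truncation of t after the term of index m shows that the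
    trace contains (x, m). Conversely, if the image of t is congruent to u
    enumerated before x, then so is the image of some y supported below x;
    purity makes t - y divisible by p^(m+1) in N, so y agrees with t at the
    coordinate (m, a_m), where t does not vanish, and a_m < x. *)
Lemma trace_pure_embedding : exists phi, forall x, closed_under R phi x ->
  forall c d, (forall m n, (m <= n)%N -> R (A c d m) (A c d n)) ->
  forall m, trace p R g (f (test_tail p A c d 0)) x m <-> slt R (A c d m) x.
Proof.
have Lunc : ~ ([set: L] #<= [set: nat]).
  by move=> Ln; apply: ML.2; apply: card_le_trans Ln _; exact/infiniteP.
pose supp (y : test_group p A) b := forall n a, val y n a <> 0 -> slt R a b.
have suppW y b b' : R b b' -> supp y b -> supp y b'.
  by move=> bb' yb n a /yb ab; exact: slt_le_trans bb'.
have /choice[phi1 phi1P] : forall b, exists c, forall u, g u = b ->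
    forall m y v, f y - u = v *+ p ^ m.+1 ->
    exists2 y', supp y' c & exists v', f y' - u = v' *+ p ^ m.+1.
  move=> b; have [[u ub]|nu] := pselect (exists u, g u = b); last first.
    by exists b => u ub; case: nu; exists u.
  have /choice[h hP] : forall m, exists c, forall y v,
      f y - u = v *+ p ^ m.+1 ->
      exists2 y', supp y' c & exists v', f y' - u = v' *+ p ^ m.+1.
    move=> m; have [[y [v yv]]|ny] := pselect
        (exists y v, f y - u = v *+ p ^ m.+1); last first.
      by exists b => y v yv; case: ny; exists y, v.
    have [c cP] := test_group_support b Rwo (fun h => @Lreg _ h Lunc) y.
    by exists c => _ _ _; exists y => //; exists v.
  have [c cP] := @Lreg _ h Lunc; exists c => u'.
  rewrite -ub => /gI-> m y v /hP[y' y'm yv'].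
  by exists y' => //; apply: suppW y'm; exact/(slt_le Rwo).
(* fewer than |L| finite sequences lie below b, hence a bound *)
have /choice[phi2 phi2P] : forall b, exists c, forall s m,
    (forall n, (n < m)%N -> R (s n) b) -> slt R (g (f (partial_sum p A s m))) c.
  move=> b; have [b' bb'] := succ_exists Lreg Minf ML b.
  have [c cP] := @Lreg _
    (fun q : seq (seg R b') => g (f (partial_sum p A (nth b (map val q)) (size q))))
    (card_seq_lt Minf ML (@Lini b')).
  exists c => s m sb.
  have sb' (n : 'I_m) : slt R (s n) b' by apply: le_slt_trans bb' => //; exact: sb.
  pose q := [seq exist (fun y => slt R y b') (s n) (sb' n) | n : 'I_m].
  suff -> : partial_sum p A s m = partial_sum p A (nth b (map val q)) (size q).
    exact: cP.
  rewrite size_map size_enum_ord; apply: eq_bigr => i _.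
  rewrite -map_comp (nth_map i) ?size_enum_ord//=.
  by rewrite nth_ord_enum.
have /choice[phi phiP] : forall b, exists c, R (phi1 b) c /\ R (phi2 b) c.
  by move=> b; exact: max_exists Rwo _ _.
exists phi => x clx c d amono m.
split=> [[u' [v [u'x fv]]]|ax]; last first.
  exists (f (partial_sum p A (A c d) m.+1)), (f (test_tail p A c d m.+1)).
  split; last first.
    by rewrite (test_tail_expansion p A c d m.+1) raddfD raddfMn addrC addKr.
  apply: slt_le_trans (slt_le Rwo (clx _ ax)) => //.
  apply: slt_le_trans (phiP _).2 => //; apply: phi2P => n nm.
  exact: amono.
have [y' suppy [v' fv']] := phi1P _ _ erefl m _ _ fv.
have [fI [_ fpur]] := fpure.
set t := test_tail p A c d 0 in fv *.
have [z tz] : exists z, t - y' = z *+ p ^ m.+1.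
  have : (range f `&` [set w *+ p ^ m.+1 | w in [set: U]]) (f (t - y')).
    split; first by exists (t - y').
    exists (v - v') => //; rewrite mulrnBl -fv -fv' (raddfB f).
    by rewrite opprB addrA subrK.
  rewrite setIC fpur => -[_ [z _ <-]]; rewrite -raddfMn => /fI zt.
  by exists z.
have : val y' m (A c d m) <> 0.
  move=> y0; have := tail_sum_coord pp (A c d) m; move/eqP; apply.
  have : val (t - y') m (A c d m) = 0 by rewrite tz raddfMn torsion_coord.
  by rewrite raddfB dep_prodB /GRing.add /= [X in _ + X]/GRing.opp /= y0 subr0.
move=> /suppy am; apply: slt_le_trans am _ => //.
by apply: (wo_trans Rwo) (phiP _).1 _; apply: slt_le => //; exact: clx.
Qed.

End Trace.

Theorem lemma3p8 (p : nat) (hp : prime p)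
    (lambda mu mu_succ : Type)
    (hlambda : regular_card lambda)
    (hmu : infinite_set [set: mu])
    (hmu_succ : is_succ_card mu mu_succ)
    (hlow : card_lt [set: mu_succ] [set: lambda])
    (hhigh : card_lt [set: lambda] [set: nat -> mu]) :
  ~ has_universal_p_group p lambda.
Proof.
move=> [U [_ UL Uuniv]].
have [Linf [R [Rini Rcof]]] := hlambda; have [Rwo _] := Rini.
have Lini := initial_seg_lt Rini.
have Lreg X h := @regular_bounded _ R X h Rwo Rcof.
have [MS SM] := hmu_succ.1; have [SL LS] := hlow.
have ML : card_lt [set: mu] [set: lambda].
  by split=> [|LM]; [exact: card_le_trans SL|apply: LS; exact: card_le_trans MS].
have [F FP] := weak_club_guessing Rwo Lini Lreg hmu ML
  (seg_between (fun h => Lreg _ h LS) SL SM).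
have U_L : [set: U] #<= [set: lambda].
  by move: UL; rewrite card_eq_le => /andP[].
have /cardT_leP[g gI] := U_L.
have MU : ~ ([set: nat -> mu] #<= [set: U]).
  by move=> h; apply: hhigh.2; exact: card_le_trans U_L.
have /choice[A' A'P] : forall cd : lambda * lambda, exists a : nat -> lambda,
    (exists2 t : mu -> lambda, injective t & forall m, F cd.1 cd.2 (t m)) ->
    [/\ forall n, F cd.1 cd.2 (a n), forall m n, (m <= n)%N -> R (a m) (a n) &
    forall u, ~ (forall x, F cd.1 cd.2 x -> forall m,
      trace p R g u x m <-> slt R (a m) x)].
  move=> [c d] /=.
  have [[t tI tF]|nt] := pselect (exists2 t : mu -> lambda, injective t &
      forall m, F c d (t m)); last by exists (fun=> c).
  by have [a aP] := avoiding_sequence (trace p R g) Rwo hmu MU tI tF; exists a.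
pose A c d := A' (c, d).
have [f fpure] := Uuniv (test_group p A) (test_group_torsion (A := A) hp)
  (card_test_group p A Linf).
have [phi phiP] := trace_pure_embedding hp Rwo Lini Lreg hmu ML gI fpure.
have [c [d [tF Fphi]]] := FP phi.
have [_ amono aP] := A'P (c, d) tF.
apply: (aP (f (test_tail p A c d 0))) => x Fx m.
exact: phiP (Fphi x Fx) _ _ amono _.
Qed.
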